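(* Let $n\ge1$ and $p$ a prime. The radical $\mathcal{R}(n,p)$ of $\Sigma(n,p)$ equals $\ker\phi$, and it is spanned (over $\mathbb{F}_p$) by all elements $\overline{B}_q-\overline{B}_r$ with $q\approx r$, together with all $\overline{B}_q$ such that some positive integer occurs at least $p$ times as a component of $q$.
   Context: A composition of $n$ is a sequence of positive integers with sum $n$; $q\approx r$ means $r$ is a reordering of the components of $q$. The descent algebra $\Sigma_n$ has basis $\{B_q\}$ indexed by compositions of $n$ with multiplication $B_qB_r=\sum_{Z\in S(q,r)}B_{c(Z)}$, where for $q=[a_1,\dots,a_s]$, $r=[b_1,\dots,b_t]$, $S(q,r)$ is the set of $s\times t$ non-negative integer matrices with row sums $a_i$ and column sums $b_j$, and $c(Z)$ is the composition obtained by reading the entries of $Z$ row by row and omitting zeros. Let $\mathcal{Z}_n$ be the subring of integral combinations of the $B_q$ and $\Sigma(n,p)=\mathcal{Z}_n/p\mathcal{Z}_n$, an $\mathbb{F}_p$-algebra with basis $\overline{B}_q$ (images of $B_q$); $\mathcal{R}(n,p)$ denotes its (Jacobson) radical. For a composition $q=[a_1,\dots,a_r]$ let $\chi_q$ be the permutation character of $S_n$ induced from the trivial character of the Young subgroup $S_{a_1}\times\cdots\times S_{a_r}$, let $G_n$ be the ring (under pointwise operations) of integral combinations of the $\chi_q$, and let $G(n,p)$ be the $\mathbb{F}_p$-algebra obtained by reducing all character values of elements of $G_n$ modulo $p$; write $\tilde\chi_q$ for the reduction of $\chi_q$. The map $\phi:\Sigma(n,p)\to G(n,p)$ is the $\mathbb{F}_p$-linear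 map with $\phi(\overline{B}_q)=\tilde\chi_q$ for all compositions $q$; it is a surjective homomorphism of $\mathbb{F}_p$-algebras (as a consequence of Solomon's theorem that $B_q\mapsto\chi_q$ defines a ring homomorphism $\mathcal{Z}_n\to G_n$). *)

(* Defs.v *)
From HB Require Import structures.
From mathcomp Require Import all_boot all_order all_algebra all_fingroup all_solvable all_field all_character.
Set Implicit Arguments. Unset Strict Implicit. Unset Printing Implicit Defensive.
Import Order.TTheory GRing.Theory Num.Theory.
Local Open Scope ring_scope.

(* A composition of n is a sequence of positive integers with sum n.  Every  *)
(* composition of n has at most n parts, each at most n, so compositions of  *)
(* n are represented (injectively and exhaustively) as n-bounded sequences   *)
(* of elements of 'I_n.+1; this gives a finType.                            *)
Definition is_comp (n : nat) (s : seq nat) : bool :=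
  all (fun a => 0 < a)%N s && (sumn s == n).

Definition comp (n : nat) := {s : n.-bseq 'I_n.+1 | is_comp n (map val s)}.

Definition compseq n (q : comp n) : seq nat := map val (val (val q)).

Definition reord n (q r : comp n) : bool := perm_eq (compseq q) (compseq r).

Definition has_prep n (p : nat) (q : comp n) : bool :=
  has (fun a => (0 < a) && (p <= count_mem a (compseq q)))%N (compseq q).

(* S(q,r): s x t non-negative integer matrices with row sums a_i and column *)
(* sums b_j (entries are automatically <= n, so 'I_n.+1 entries suffice).   *)
Definition in_S n (q r : comp n)
  (Z : 'M['I_n.+1]_(size (compseq q), size (compseq r))) : bool :=
  [forall i, (\sum_j (Z i j : nat))%N == nth 0%N (compseq q) i] &&
  [forall j, (\sum_i (Z i j : nat))%N == nth 0%N (compseq r) j].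

Definition cZ n (s t : nat) (Z : 'M['I_n.+1]_(s, t)) : seq nat :=
  [seq a <- [seq (Z i j : nat) | i <- enum 'I_s, j <- enum 'I_t] | a != 0%N].

(* Sigma(n,p) = Z_n / p Z_n, an F_p-space with basis (Bbar q)_q; an element *)
(* is its coordinate function.                                             *)
Definition Sigma (n p : nat) := {ffun comp n -> 'F_p}.

Definition Bbar n p (q : comp n) : Sigma n p := [ffun r => (r == q)%:R].

(* coefficient of B_w in B_q B_r = sum_{Z in S(q,r)} B_{c(Z)}, reduced mod p *)
Definition struct_const n p (q r w : comp n) : 'F_p :=
  (#|[pred Z : 'M['I_n.+1]_(size (compseq q), size (compseq r)) |
      in_S Z & cZ Z == compseq w]|)%:R.

Definition mulS n p (x y : Sigma n p) : Sigma n p :=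
  [ffun w => \sum_(q : comp n) \sum_(r : comp n) x q * y r * struct_const p q r w].

Definition left_ideal n p (I : pred (Sigma n p)) : Prop :=
  [/\ I 0, (forall x y, I x -> I y -> I (x - y))
    & (forall a x, I x -> I (mulS a x))].

Definition maximal_left_ideal n p (I : pred (Sigma n p)) : Prop :=
  [/\ left_ideal I, (exists x, ~ I x)
    & forall J : pred (Sigma n p), left_ideal J -> (forall x, I x -> J x) ->
        (forall x, J x -> I x) \/ (forall x, J x)].

Definition radical n p (x : Sigma n p) : Prop :=
  forall I : pred (Sigma n p), maximal_left_ideal I -> I x.

Definition block n (q : comp n) (i : nat) : {set 'I_n} :=
  [set k : 'I_n | (sumn (take i (compseq q)) <= k < sumn (take i.+1 (compseq q)))%N].

(* Young subgroup S_{a_1} x ... x S_{a_r} of S_n *)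
Definition young n (q : comp n) : {group 'S_n} :=
  (\bigcap_(i < size (compseq q)) 'N(block q i | 'P))%G.

Definition chi n (q : comp n) : 'CF([set: 'S_n]) :=
  'Ind[[set: 'S_n], young q] 1.

(* reduction mod p of an (integer) character value *)
Definition redp (p : nat) (v : algC) : 'F_p := (Num.floor v)%:~R.

(* phi : Sigma(n,p) -> G(n,p), Bbar q |-> chi~_q, extended F_p-linearly; *)
(* elements of G(n,p) are viewed as F_p-valued functions on S_n.         *)
Definition phi n p (x : Sigma n p) : {ffun 'S_n -> 'F_p} :=
  [ffun g => \sum_(q : comp n) x q * redp p (chi q g)].

Definition scaleS n p (k : 'F_p) (v : Sigma n p) : Sigma n p := [ffun w => k * v w].

Definition in_span_gen n p (x : Sigma n p) : Prop :=
  exists (c : {ffun comp n * comp n -> 'F_p}) (d : {ffun comp n -> 'F_p}),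
    x = \sum_(qr | reord qr.1 qr.2) scaleS (c qr) (Bbar p qr.1 - Bbar p qr.2)
        + \sum_(q | has_prep p q) scaleS (d q) (Bbar p q).

(* Main.v *)
Require Import Defs.
From HB Require Import structures.
From mathcomp Require Import all_boot all_order all_algebra all_fingroup all_solvable all_field all_character.
Import GRing.Theory.
Local Open Scope ring_scope.
Import Num.Theory.
Set Implicit Arguments. Unset Strict Implicit. Unset Printing Implicit Defensive.

(** The value of [chi q] at [g] is the number of [g]-invariant colorings of the
    points in which color [i] is used [q_i] times.  Pairs of colorings are
    colorings by pairs of colors, which gives multiplicativity of [phi] term by
    term; hence [x |-> phi x g] is a ring homomorphism onto ['F_p], its kernel is
    a maximal left ideal, and the radical is contained in [ker phi].  Conversely
    the coefficient of [B_q] in [B_q B_r] is [chi r] at a permutation whose cycles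
    are the blocks of [q], while all other terms are strictly longer than [q]: right
    multiplication by an element of [ker phi] strictly increases the length, so
    [ker phi] consists of nilpotent elements and lies in every maximal left ideal
    (associativity is never needed).  For the spanning set, the permutations of
    equal parts act freely on colorings, so [p] divides [chi q] if a part is
    repeated [p] times; otherwise [chi q] at its own cycle type is the order of
    that group, prime to [p], and the classes [chi q] up to reordering are
    triangular with respect to length. *)

(** * Blocks of a composition *)

Lemma card_ord_interval (n lo hi : nat) :
  (hi <= n)%N -> #|[set k : 'I_n | (lo <= k < hi)%N]| = (hi - lo)%N.
Proof.
move=> le_hi_n; rewrite cardsE cardE /enum_mem size_filter -enumT.
rewrite -(count_map val (fun k => lo <= k < hi)%N) val_enum_ord.
have [le_lo_hi | lt_hi_lo] := leqP lo hi; last first.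
  have /eqP-> : (hi - lo == 0)%N by rewrite subn_eq0 ltnW.
  apply/eqP; rewrite -leqn0 leqNgt -has_count; apply/hasPn=> k _.
  by apply/negP=> /andP[h1 h2]; have := leq_ltn_trans h1 (ltn_trans h2 lt_hi_lo); rewrite ltnn.
have -> : iota 0 n = iota 0 lo ++ iota lo (hi - lo) ++ iota hi (n - hi).
  by rewrite -{2}(subnKC le_lo_hi) -iotaD -{1}(add0n lo) -iotaD addnA subnKC // subnKC.
rewrite !count_cat.
have -> : count (fun k => lo <= k < hi)%N (iota 0 lo) = 0%N.
  apply/eqP; rewrite -leqn0 leqNgt -has_count; apply/hasPn=> k.
  by rewrite mem_iota => /andP[_ h]; rewrite leqNgt h.
have -> : count (fun k => lo <= k < hi)%N (iota hi (n - hi)) = 0%N.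
  apply/eqP; rewrite -leqn0 leqNgt -has_count; apply/hasPn=> k.
  by rewrite mem_iota => /andP[h _]; rewrite [(k < hi)%N]ltnNge h andbF.
rewrite add0n addn0 -[RHS](size_iota lo); apply/eqP; rewrite -all_count.
by apply/allP=> k; rewrite mem_iota subnKC.
Qed.

(** Bridges the interval description used in [block] and the block number computed by
    [reshape_index], so that the blocks become the fibres of one map. *)
Lemma reshape_index_interval (sh : seq nat) (k i : nat) : (k < sumn sh)%N ->
  (sumn (take i sh) <= k < sumn (take i.+1 sh))%N = (reshape_index sh k == i).
Proof.
have tS (j : nat) : sumn (take j.+1 sh) = (sumn (take j sh) + nth 0 sh j)%N.
  have [lt_j | le_j] := ltnP j (size sh).
    by rewrite (take_nth 0%N) // sumn_rcons.
  by rewrite nth_default // addn0 !take_oversize // ltnW.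
move=> lt_k; apply/andP/eqP=> [[h1 h2] | <-].
  rewrite -(subnKC h1) flatten_indexKl // -(ltn_add2l (sumn (take i sh))).
  by rewrite subnKC // -tS.
move: (reshape_indexK sh k) (reshape_offsetP lt_k); rewrite /flatten_index.
set r := reshape_index sh k => eq_k lt_c.
by rewrite tS -eq_k leq_addr ltn_add2l.
Qed.

Section Compositions.
Variables (n : nat) (q : Defs.comp n).

Lemma compseq_sum : sumn (compseq q) = n.
Proof. by have /andP[_ /eqP] := valP q. Qed.

Lemma compseq_gt0 a : a \in compseq q -> (0 < a)%N.
Proof. by have /andP[/allP h _] := valP q; apply: h. Qed.

Definition part (i : 'I_(size (compseq q))) : nat := nth 0%N (compseq q) i.

Lemma comp_part_gt0 i : (0 < part i)%N.
Proof. by apply: compseq_gt0; rewrite mem_nth. Qed.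

Fact blk_subproof (k : 'I_n) :
  (reshape_index (compseq q) k < size (compseq q))%N.
Proof. by rewrite reshape_indexP // compseq_sum. Qed.

(** The decomposition into blocks viewed as a coloring of the points by block numbers; the Young
    subgroup is then the stabilizer of this one coloring. *)
Definition blk : {ffun 'I_n -> 'I_(size (compseq q))} :=
  [ffun k => Ordinal (blk_subproof k)].

Lemma in_block k (i : 'I_(size (compseq q))) : (k \in block q i) = (blk k == i).
Proof. by rewrite inE reshape_index_interval ?compseq_sum // ffunE. Qed.

Lemma card_blk i : #|[set k | blk k == i]| = part i.
Proof.
have -> : [set k | blk k == i] = block q i.
  by apply/setP=> k; rewrite in_block inE.
rewrite card_ord_interval; last first.
  rewrite -[leqRHS]compseq_sum -[X in (_ <= sumn X)%N](cat_take_drop i.+1).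
  by rewrite sumn_cat leq_addr.
by rewrite (take_nth 0%N) // sumn_rcons addKn.
Qed.

Lemma in_young s : (s \in young q) = [forall k, blk (s k) == blk k].
Proof.
apply/bigcapP/forallP=> [h k | h i _].
  have /astabsP/(_ k) := h (blk k) isT.
  by rewrite !in_block eqxx.
by apply/astabsP=> k; rewrite !in_block; move/eqP: (h k) => /= ->.
Qed.

End Compositions.
Arguments part {n} q i.

(** * Invariant colorings and the values of [chi] *)

Section Colorings.
Variables (n : nat) (J : finType) (a : J -> nat).
Implicit Types (F : {ffun 'I_n -> J}) (g : 'S_n).

Definition colorings : {set {ffun 'I_n -> J}} :=
  [set F : {ffun 'I_n -> J} | [forall j, #|[set k | F k == j]| == a j]].

Definition inv_colorings g :=
  [set F : {ffun 'I_n -> J} in colorings | [forall k, F (g k) == F k]].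

Lemma inv_coloringsP F g :
  reflect ((forall j, #|[set k | F k == j]| = a j) /\ (forall k, F (g k) = F k))
          (F \in inv_colorings g).
Proof.
rewrite !inE; apply: (iffP andP) => [[/forallP h1 /forallP h2] | [h1 h2]].
  by split=> [j | k]; apply/eqP.
by split; apply/forallP=> j; apply/eqP.
Qed.

(** Transitivity of ['S_n] on colorings with prescribed counts: the two tuples of values are
    reorderings of each other, and such a reordering is a permutation of the points. *)
Lemma colorings_perm F F' : F \in colorings -> F' \in colorings ->
  exists s : 'S_n, F' = [ffun k => F (s k)].
Proof.
rewrite !inE => /forallP h /forallP h'.
have cnt (G : {ffun 'I_n -> J}) j :
    count_mem j [tuple G k | k < n] = #|[set k | G k == j]|.
  by rewrite /= count_map cardsE cardE {2}/enum_mem size_filter enumT; apply: eq_count.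
have : perm_eq [tuple F' k | k < n] [tuple F k | k < n].
  apply/allP=> j _; apply/eqP; etransitivity; first exact: cnt.
  by rewrite (eqP (h' j)) -(eqP (h j)); symmetry; apply: cnt.
case/tuple_permP=> s E; exists s; apply/ffunP=> k; rewrite ffunE.
have /val_inj/(congr1 (fun t => tnth t k)) := E.
by rewrite !tnth_mktuple.
Qed.

End Colorings.
Arguments colorings {n J} a.

Definition fixnum n (q : Defs.comp n) (g : 'S_n) : nat := #|inv_colorings (part q) g|.

(** Sort the [y] by the coloring [f y] pulled back from [blk q]. The conjugate [g ^ y] lies in the
    Young subgroup exactly when [f y] is [g]-invariant, and by transitivity every coloring comes
    from one left coset of [young q]. *)
Lemma card_conj_young n (q : Defs.comp n) g :
  #|[set y | (g ^ y)%g \in young q]| = (#|young q| * fixnum q g)%N.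
Proof.
pose f (y : 'S_n) : {ffun 'I_n -> 'I_(size (compseq q))} := [ffun k => blk q (y k)].
have f_col y : f y \in colorings (part q).
  rewrite inE; apply/forallP=> j; rewrite -card_blk -(card_preimset [set k | blk q k == j] (@perm_inj _ y)).
  by apply/eqP/eq_card=> k; rewrite !inE ffunE.
have fJ y : ((g ^ y)%g \in young q) = (f y \in inv_colorings (part q) g).
  rewrite in_young inE f_col /=; apply/forallP/forallP=> h k.
    by have := h (y k); rewrite !ffunE /conjg !permM permK.
  by have := h ((y^-1)%g k); rewrite !ffunE /conjg !permM permKV.
rewrite -sum1_card (partition_big f (mem (inv_colorings (part q) g))) /=; last first.
  by move=> y; rewrite inE fJ.
rewrite mulnC -sum_nat_const; apply: eq_bigr => F Fg.
have /setIdP[Fc _] := Fg.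
have blkc : blk q \in colorings (part q).
  by rewrite inE; apply/forallP=> j; rewrite card_blk.
have [y0 Ey0] := colorings_perm blkc Fc.
rewrite -(card_lcoset _ y0) sum1_card; apply: eq_card => y.
transitivity ((f y \in inv_colorings (part q) g) && (f y == F)).
  by rewrite unfold_in inE; congr andb; apply: fJ.
transitivity ((y0^-1 * y)%g \in young q); last by rewrite mem_lcoset.
rewrite in_young.
apply/andP/forallP=> [[_ /eqP Ef] k | h].
  have := congr1 (fun G : {ffun _ -> _} => G (y0^-1 k)%g) Ef.
  by rewrite Ey0 !ffunE permM permKV => ->.
have Ef : f y = F.
  apply/ffunP=> k; have := h (y0 k).
  by rewrite permM permK Ey0 !ffunE => /eqP.
by rewrite Ef.
Qed.

Lemma chiE n (q : Defs.comp n) g : chi q g = (fixnum q g)%:R.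
Proof.
rewrite /chi cfIndE ?subsetT //.
under eq_bigr => y _ do rewrite cfun1E.
rewrite -natr_sum (_ : (\sum_(y in [set: 'S_n]) _)%N = (#|young q| * fixnum q g)%N).
  by rewrite natrM mulKf // pnatr_eq0 -lt0n cardG_gt0.
rewrite -card_conj_young -sum1dep_card [RHS]big_mkcond /=.
by apply: eq_big => [y | y _]; rewrite ?inE //; case: ifP.
Qed.

Lemma redp_nat p m : redp p m%:R = m%:R.
Proof. by rewrite /redp -[m%:R]/((m%:Z)%:~R) intrKfloor. Qed.

(** * Compositions as sequences, and invariance under reordering *)

Lemma compseq_inj n : injective (@compseq n).
Proof. by move=> q r /(inj_map val_inj)/val_inj/val_inj. Qed.

Lemma compseq_onto n (s : seq nat) : is_comp n s -> exists q : Defs.comp n, compseq q = s.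
Proof.
move=> cs; have /andP[/allP s_gt0 /eqP sum_s] := cs.
have le_s a : a \in s -> (a < n.+1)%N.
  move=> /rot_to[i s' E]; have /permPl/perm_sumn := perm_rot i s.
  by rewrite ltnS -sum_s E => <-; apply: leq_addr.
have sz_s : (size s <= n)%N.
  rewrite -sum_s; move: s_gt0 {cs sum_s le_s}; elim: s => //= a s IHs s_gt0.
  rewrite -add1n leq_add ?s_gt0 ?mem_head // IHs // => b sb.
  by rewrite s_gt0 // inE sb orbT.
have val_s : map val (map (@inord n) s) = s.
  by rewrite -map_comp map_id_in // => a /le_s; apply: inordK.
have sz_s' : (size (map (@inord n) s) <= n)%N by rewrite size_map.
have cs' : is_comp n (map val (val (Bseq sz_s'))) by rewrite /= val_s.
by exists (exist _ (Bseq sz_s') cs').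
Qed.

Lemma card_inv_colorings_inj n (J J' : finType) (h : J -> J') a a' (g : 'S_n) :
    injective h -> (forall j, a' (h j) = a j) ->
    (forall j', a' j' != 0%N -> exists j, j' = h j) ->
  #|inv_colorings a g| = #|inv_colorings a' g|.
Proof.
move=> inj_h ah a'h.
pose hh (F : {ffun 'I_n -> J}) : {ffun 'I_n -> J'} := [ffun k => h (F k)].
have inj_hh : injective hh.
  move=> F1 F2 E; apply/ffunP=> k; apply: inj_h.
  by have := congr1 (fun G : {ffun _ -> _} => G k) E; rewrite !ffunE.
rewrite -(card_imset _ inj_hh); apply: eq_card => F'.
apply/imsetP/inv_coloringsP=> [[F /inv_coloringsP[h1 h2] ->] | [h1 h2]].
  split=> [j' | k]; last by rewrite !ffunE h2.
  have [/eqP a'0 | /a'h[j ->]] := boolP (a' j' == 0%N); last first.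
    by rewrite ah -h1; apply: eq_card => k; rewrite !inE ffunE (inj_eq inj_h).
  rewrite a'0; apply: eq_card0 => k; rewrite !inE ffunE.
  apply: contraTF (isT) => /eqP E; move: (ah (F k)); rewrite E a'0 => a0.
  move: (h1 (F k)); rewrite -a0 => /eqP; rewrite cards_eq0 => /eqP/setP/(_ k).
  by rewrite !inE eqxx.
have F'h k : exists j, F' k == h j.
  have /a'h[j ->] : a' (F' k) != 0%N.
    by rewrite -h1 cards_eq0; apply/set0Pn; exists k; rewrite inE.
  by exists j.
pose F : {ffun 'I_n -> J} := [ffun k => xchoose (F'h k)].
have FE : F' = hh F.
  by apply/ffunP=> k; rewrite !ffunE; apply/eqP/(xchooseP (F'h k)).
exists F => //; apply/inv_coloringsP; split=> [j | k].
  by rewrite -ah -h1; apply: eq_card => k; rewrite !inE FE [in RHS]ffunE (inj_eq inj_h).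
by apply: inj_h; have := h2 k; rewrite FE !ffunE.
Qed.

(** Drops the colors of count 0 and renames the others by positions in [q]. It serves both for
    reordered compositions and for passing from a matrix [Z] to [cZ Z]. *)
Lemma card_inv_colorings_comp n (J : finType) (a : J -> nat) (q : Defs.comp n) (g : 'S_n) :
    perm_eq (compseq q) [seq a j | j <- enum J & a j != 0%N] ->
  #|inv_colorings a g| = fixnum q g.
Proof.
set s := filter _ _ => /(perm_iotaP 0%N)[Is].
rewrite size_map => pIs Eq; pose s' := in_tuple s.
have szIs : size Is = size (compseq q) by rewrite Eq size_map.
have IsP (i : 'I_(size (compseq q))) : (nth 0 Is i < size s)%N.
  have : nth 0%N Is i \in iota 0 (size s).
    by rewrite -(perm_mem pIs) mem_nth ?szIs.
  by rewrite mem_iota.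
(* [Is] realizes the reordering: part [i] of [q] is the count of color number [nth 0 Is i] in [s],
   and [h] sends [i] to that color. *)
pose h i := tnth s' (Ordinal (IsP i)).
have us : uniq s by rewrite filter_uniq ?enum_uniq.
symmetry; apply: (@card_inv_colorings_inj _ _ _ h).
- move=> i i' /(tuple_uniqP s' us)[] /eqP.
  rewrite nth_uniq ?szIs // => [/eqP/val_inj //|].
  by rewrite (perm_uniq pIs) iota_uniq.
- move=> i; rewrite /part {1}Eq (nth_map 0%N) ?szIs //.
  rewrite /h (tnth_nth (h i)) /= -(nth_map _ 0%N) //.
move=> j' a'j'; have /tnthP[i Ei] : j' \in s' by rewrite mem_filter a'j' mem_enum.
have : val i \in Is by rewrite (perm_mem pIs) mem_iota /=; apply: ltn_ord.
move=> Isi; have lt_i : (index (val i) Is < size (compseq q))%N.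
  by rewrite -szIs index_mem.
exists (Ordinal lt_i); rewrite Ei /h; congr (tnth _ _); apply/val_inj.
by rewrite /= nth_index.
Qed.

Lemma map_part n (q : Defs.comp n) : [seq part q i | i <- enum 'I_(size (compseq q))] = compseq q.
Proof.
rewrite -[RHS](mkseq_nth 0%N) /mkseq -val_enum_ord -map_comp.
exact: eq_map.
Qed.

Lemma sum_part n (q : Defs.comp n) : (\sum_i part q i)%N = n.
Proof. by rewrite -big_enum -(big_map (part q) xpredT id) map_part -sumnE compseq_sum. Qed.

Lemma fixnum_reord n (q r : Defs.comp n) g : reord q r -> fixnum q g = fixnum r g.
Proof.
move=> qr; apply: card_inv_colorings_comp.
rewrite (all_filterP _) ?map_part 1?perm_sym //; apply/allP=> i _.
rewrite -lt0n. apply: comp_part_gt0.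
Qed.

(** * Multiplicativity of the coloring counts *)

Section Product.
Variables (n : nat) (q r : Defs.comp n).
Local Notation s := (size (compseq q)).
Local Notation t := (size (compseq r)).
Implicit Type Z : 'M['I_n.+1]_(s, t).

Lemma in_SP Z : reflect ((forall i, (\sum_j (Z i j : nat))%N = part q i) /\
   (forall j, (\sum_i (Z i j : nat))%N = part r j)) (in_S Z).
Proof.
apply: (iffP andP) => [[/forallP h1 /forallP h2] | [h1 h2]].
  by split=> i; apply/eqP.
by split; apply/forallP=> i; apply/eqP; rewrite ?h1 ?h2.
Qed.

(** Only the multiset of nonzero entries matters for counting colorings, so reading row by row is
    traded for an enumeration of index pairs. *)
Lemma perm_cZ Z : perm_eq (cZ Z)
  [seq (Z ij.1 ij.2 : nat) | ij <- enum {: 'I_s * 'I_t} & (Z ij.1 ij.2 : nat) != 0%N].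
Proof.
rewrite /cZ -[X in perm_eq _ X](filter_map (fun ij => (Z ij.1 ij.2 : nat)) (fun x => x != 0%N)).
apply: perm_filter.
rewrite -(map_allpairs (fun ij => (Z ij.1 ij.2 : nat)) pair).
apply: perm_map; apply: uniq_perm; rewrite ?enum_uniq //.
  by apply: allpairs_uniq; rewrite ?enum_uniq // => -[? ?] [? ?].
by case=> i j; rewrite mem_enum allpairs_f ?mem_enum.
Qed.

Lemma sumn_cZ Z : in_S Z -> sumn (cZ Z) = n.
Proof.
move=> /in_SP[h _]; rewrite (perm_sumn (perm_cZ Z)) sumnE big_map big_filter big_enum_cond /=.
rewrite -(pair_big_dep xpredT (fun i j => (Z i j : nat) != 0%N) (fun i j => (Z i j : nat))) /=.
rewrite -[RHS](sum_part q); apply: eq_bigr => i _; rewrite -h [RHS](bigID (fun j => (Z i j : nat) != 0%N)) /=.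
by rewrite [X in (_ + X)%N]big1 ?addn0 // => j; rewrite negbK => /eqP.
Qed.

Lemma cZ_comp Z : in_S Z -> is_comp n (cZ Z).
Proof.
move=> SZ; rewrite /is_comp sumn_cZ // eqxx andbT; apply/allP=> a.
by rewrite mem_filter lt0n => /andP[].
Qed.

(** For a coloring by pairs, the matrix [joint F] of counts has the color counts of the two
    components as row and column sums; sorting by this matrix indexes the sum by S(q,r). *)
Lemma fixnumM g : (fixnum q g * fixnum r g)%N =
  (\sum_(Z : 'M['I_n.+1]_(s, t) | in_S Z)
     #|inv_colorings (fun ij => Z ij.1 ij.2 : nat) g|)%N.
Proof.
pose joint (F : {ffun 'I_n -> 'I_s * 'I_t}) : 'M['I_n.+1]_(s, t) :=
  \matrix_(i, j) inord #|[set k | F k == (i, j)]|.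
have jointE F i j : joint F i j = #|[set k | F k == (i, j)]| :> nat.
  by rewrite mxE inordK // ltnS -[leqRHS]card_ord max_card.
pose pr1 (F : {ffun 'I_n -> 'I_s * 'I_t}) : {ffun 'I_n -> 'I_s} := [ffun k => (F k).1].
pose pr2 (F : {ffun 'I_n -> 'I_s * 'I_t}) : {ffun 'I_n -> 'I_t} := [ffun k => (F k).2].
have row_joint F i : (\sum_j (joint F i j : nat))%N = #|[set k | pr1 F k == i]|.
  rewrite -[RHS]sum1_card (partition_big (pr2 F) xpredT) //=.
  apply: eq_bigr => j _; rewrite jointE -sum1_card; apply: eq_bigl => k.
  by rewrite !inE !ffunE; case: (F k).
have col_joint F j : (\sum_i (joint F i j : nat))%N = #|[set k | pr2 F k == j]|.
  rewrite -[RHS]sum1_card (partition_big (pr1 F) xpredT) //=.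
  apply: eq_bigr => i _; rewrite jointE -sum1_card; apply: eq_bigl => k.
  by rewrite !inE !ffunE andbC; case: (F k).
pose A := [set F | (pr1 F \in inv_colorings (part q) g) && (pr2 F \in inv_colorings (part r) g)].
transitivity #|A|.
  rewrite -cardsX.
  pose pr F := (pr1 F, pr2 F).
  have inj_pr : injective pr.
    move=> F1 F2 [E1 E2]; apply/ffunP=> k.
    have := congr1 (fun G : {ffun _ -> _} => G k) E1.
    have := congr1 (fun G : {ffun _ -> _} => G k) E2.
    by rewrite !ffunE; case: (F1 k) (F2 k) => [? ?] [? ?] /= -> ->.
  rewrite -(card_imset (mem A) inj_pr); apply: eq_card => -[F1 F2]; rewrite inE /=.
  apply/andP/imsetP=> [[h1 h2] | [F]]; last first.
    by rewrite inE => /andP[? ?] [-> ->].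
  have E1 : pr1 [ffun k => (F1 k, F2 k)] = F1 by apply/ffunP=> k; rewrite !ffunE.
  have E2 : pr2 [ffun k => (F1 k, F2 k)] = F2 by apply/ffunP=> k; rewrite !ffunE.
  exists [ffun k => (F1 k, F2 k)]; last by rewrite /pr E1 E2.
  by rewrite in_set E1 E2 h1.
rewrite -sum1_card (partition_big joint (@in_S n q r)) /=; last first.
  move=> F; rewrite inE => /andP[/inv_coloringsP[h1 _] /inv_coloringsP[h2 _]].
  by apply/in_SP; split=> i; rewrite ?row_joint ?col_joint ?h1 ?h2.
apply: eq_bigr => Z /in_SP[Z1 Z2]; rewrite sum1_card; apply: eq_card => F.
rewrite unfold_in inE; apply/andP/inv_coloringsP.
  case=> [/andP[/inv_coloringsP[_ h1] /inv_coloringsP[_ h2]] /eqP <-].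
  split=> [[i j] | k]; first by rewrite jointE.
  have := h1 k; have := h2 k; rewrite !ffunE.
  by case: (F (g k)) (F k) => [? ?] [? ?] /= -> ->.
case=> h1 h2; have EZ : joint F = Z.
  by apply/matrixP=> i j; apply/val_inj/(etrans (jointE _ _ _))/(h1 (i, j)).
rewrite EZ; split=> //; apply/andP; split; apply/inv_coloringsP; split=> i.
- by rewrite -row_joint EZ.
- by rewrite !ffunE h2.
- by rewrite -col_joint EZ.
- by rewrite !ffunE h2.
Qed.

(** Each [Z] contributes to the single [w] with [compseq w = cZ Z], and its colorings by pairs are
    as many as the colorings for [w]. *)
Lemma fixnumM_struct p g : (fixnum q g)%:R * (fixnum r g)%:R =
  \sum_(w : Defs.comp n) struct_const p q r w * (fixnum w g)%:R.
Proof.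
rewrite -natrM fixnumM.
have cZq Z : in_S Z -> [exists w : Defs.comp n, cZ Z == compseq w].
  by move=> /cZ_comp/compseq_onto[w Ew]; apply/existsP; exists w; rewrite Ew.
under [RHS]eq_bigr => w _ do rewrite /struct_const -natrM -sum1_card big_distrl.
rewrite -natr_sum; congr (_ %:R); rewrite (exchange_big_dep (@in_S n q r)) /=; last first.
  by move=> w Z _; rewrite unfold_in /= => /andP[].
apply: eq_bigr => Z SZ; have /existsP[w /eqP Ew] := cZq Z SZ.
rewrite (big_pred1 w) => [|w'].
  by rewrite mul1n; apply: card_inv_colorings_comp; rewrite -Ew perm_cZ.
by rewrite unfold_in /= SZ Ew (inj_eq (@compseq_inj n)) eq_sym.
Qed.

End Product.

(** * Permutations with prescribed cycles *)

Lemma perm_with_cycles (T : finType) (B : eqType) (b : T -> B) :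
  exists g : {perm T}, forall (J : Type) (F : T -> J),
    (forall k, F (g k) = F k) <-> (forall k k', b k = b k' -> F k = F k').
Proof.
pose c k := enum [pred k' | b k' == b k].
have uc k : uniq (c k) by apply: enum_uniq.
have in_c k k' : (k' \in c k) = (b k' == b k) by rewrite mem_enum inE.
have c_next k : b (next (c k) k) = b k.
  by apply/eqP; rewrite -in_c mem_next in_c.
(* The permutation runs cyclically through the enumeration of each fibre of [b], and [prev] undoes
   it; its cycles are therefore the nonempty fibres. *)
have inj_next : injective (fun k => next (c k) k).
  move=> k k' E; have Eb : b k = b k' by rewrite -c_next E c_next.
  have Ec : c k = c k' by apply: eq_enum => x; rewrite !inE Eb.
  by rewrite -(prev_next (uc k) k) E Ec (prev_next (uc k')).
exists (perm inj_next) => J F; split=> [inv_F k k' Eb | inv_F k]; last first.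
  by rewrite permE; apply: inv_F; apply: c_next.
have : fconnect (next (c k)) k k'.
  by rewrite (fconnect_cycle (cycle_next (uc k))) in_c ?Eb.
case/connectP=> s; elim: s k Eb => [|k1 s IHs] k Eb /= => [_ -> // | /andP[/eqP E1 ps] El].
have Eb1 : b k1 = b k by rewrite -E1 c_next.
have Ec : c k1 = c k by apply: eq_enum => x; rewrite !inE Eb1.
by rewrite -(inv_F k) permE E1; apply: IHs => //; rewrite ?Ec ?Eb1.
Qed.

(** * Leading terms of a product of basis elements *)

Section RowByRow.
Variables (n : nat) (q r : Defs.comp n).
Local Notation s := (size (compseq q)).
Local Notation t := (size (compseq r)).
Variable Z : 'M['I_n.+1]_(s, t).
Hypothesis SZ : in_S Z.

Let row_nz (i : 'I_s) := [seq a <- [seq (Z i j : nat) | j <- enum 'I_t] | a != 0%N].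

Let cZ_rows : cZ Z = flatten [seq row_nz i | i <- enum 'I_s].
Proof. by rewrite /cZ filter_flatten -map_comp. Qed.

Let size_cZ : size (cZ Z) = (\sum_i size (row_nz i))%N.
Proof. by rewrite cZ_rows size_flatten /shape -map_comp sumnE big_map big_enum. Qed.

Let sumn_row i : sumn (row_nz i) = part q i.
Proof.
have /in_SP[h _] := SZ; rewrite sumnE big_filter big_map big_enum_cond -h.
rewrite [RHS](bigID (fun j => (Z i j : nat) != 0%N)) /= [X in (_ + X)%N]big1 ?addn0 //.
by move=> j; rewrite negbK => /eqP.
Qed.

Let size_row_gt0 i : (0 < size (row_nz i))%N.
Proof.
by have := comp_part_gt0 i; rewrite -sumn_row; case: (row_nz i).
Qed.

(** Each row sums to a positive part of [q] and so contributes at least one entry to [cZ Z]; the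
    equality case records that every row contributes just one. *)
Let size_rows : (s <= size (cZ Z) ?= iff [forall i, 1 == size (row_nz i)])%N.
Proof.
rewrite size_cZ -{1}[s]card_ord -sum1_card.
by apply: leqif_sum => i _; apply: leqif_eq.
Qed.

Let size_rowE i : size (row_nz i) = #|[set j | (Z i j : nat) != 0%N]|.
Proof.
rewrite size_filter count_map cardsE cardE {2}/enum_mem size_filter enumT.
exact: eq_count.
Qed.

Lemma leq_size_cZ : (s <= size (cZ Z))%N.
Proof. exact: size_rows. Qed.

Lemma cZ_short : (size (cZ Z) <= s)%N -> cZ Z = compseq q.
Proof.
rewrite (geq_leqif size_rows) => /forallP row1.
rewrite cZ_rows -[RHS]map_part -[RHS](flatten_map1 (part q)) //.
congr flatten; apply: eq_map => i; have := sumn_row i.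
by move: (row1 i); case: (row_nz i) => [|a []] //= _; rewrite addn0 => <-.
Qed.

(** Asking for at most one nonzero entry per row is enough, since positive row sums already force at
    least one. *)
Lemma cZ_eqP : reflect (forall i, exists j0, forall j, j != j0 -> Z i j = 0%N :> nat)
                       (cZ Z == compseq q).
Proof.
apply: (iffP eqP) => [E i | h].
  have : [forall i, 1 == size (row_nz i)] by rewrite -(geq_leqif size_rows) E.
  move=> /forallP/(_ i); rewrite size_rowE eq_sym => /cards1P[j0 Ej0]; exists j0 => j.
  by have /setP/(_ j) := Ej0; rewrite !inE => <- /negPn/eqP.
apply: cZ_short; rewrite (geq_leqif size_rows); apply/forallP=> i.
rewrite eqn_leq size_row_gt0 size_rowE; have [j0 hj0] := h i.
rewrite -(cards1 j0) subset_leq_card //; apply/subsetP=> j; rewrite !inE.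
by apply: contraR => /hj0 ->.
Qed.

End RowByRow.

Lemma struct_const_neq0 n p (q r w : Defs.comp n) :
    struct_const p q r w != 0 ->
  (size (compseq q) < size (compseq w))%N || (w == q).
Proof.
move=> nz; have : #|[pred Z | @in_S n q r Z & cZ Z == compseq w]| != 0%N.
  by apply: contraNneq nz => E; rewrite /struct_const E.
rewrite -lt0n => /card_gt0P[Z]; rewrite inE => /andP[SZ /eqP Ew].
have := leq_size_cZ SZ; rewrite leq_eqVlt Ew => /orP[/eqP Es | -> //].
rewrite -(inj_eq (@compseq_inj n)) -Ew cZ_short ?eqxx ?orbT //.
by rewrite Ew Es.
Qed.

(* The cycles of [g] are the blocks of [q], expressed through invariant
   functions because this is the only form in which it is used. *)
Definition blk_cycles n (q : Defs.comp n) (g : 'S_n) := forall (J : Type) (F : 'I_n -> J),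
  (forall k, F (g k) = F k) <-> (forall k k', blk q k = blk q k' -> F k = F k').

Lemma blk_onto n (q : Defs.comp n) i : exists k, blk q k == i.
Proof.
have : (0 < #|[set k | blk q k == i]|)%N by rewrite card_blk comp_part_gt0.
by case/card_gt0P=> k; rewrite inE; exists k.
Qed.

(** The coefficient counts the [Z] with one nonzero entry in each row. The column of that entry
    assigns a color to each block of [q], which is the same as a [g]-invariant coloring; the column
    sums prescribe its color counts. *)
Lemma struct_const_diag n p (q r : Defs.comp n) g :
  blk_cycles q g -> struct_const p q r q = (fixnum r g)%:R.
Proof.
move=> cyc_g; congr (_ %:R).
pose f (F : {ffun 'I_n -> 'I_(size (compseq r))}) :
    'M['I_n.+1]_(size (compseq q), size (compseq r)) :=
  \matrix_(i, j) inord #|[set k | (blk q k == i) && (F k == j)]|.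
have fE F i j : f F i j = #|[set k | (blk q k == i) && (F k == j)]| :> nat.
  by rewrite mxE inordK // ltnS -[leqRHS]card_ord max_card.
have f_col F j : (\sum_i (f F i j : nat))%N = #|[set k | F k == j]|.
  rewrite -[RHS]sum1_card (partition_big (blk q) xpredT) //=.
  apply: eq_bigr => i _; rewrite fE -sum1_card; apply: eq_bigl => k.
  by rewrite !inE andbC.
have f_row F i : (\sum_j (f F i j : nat))%N = part q i.
  rewrite -card_blk -[RHS]sum1_card (partition_big F xpredT) //=.
  by apply: eq_bigr => j _; rewrite fE -sum1_card; apply: eq_bigl => k; rewrite !inE.
(* For an invariant [F], the nonzero entry in the row of a block sits in the column of the color of
   that block, so [f F] determines [F]. *)
have f_blk F k j : F \in inv_colorings (part r) g ->
    (f F (blk q k) j != 0%N :> nat) = (F k == j).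
  case/inv_coloringsP=> _ /cyc_g F_blk; rewrite fE cards_eq0.
  apply/set0Pn/idP=> [[k'] | Fk]; last by exists k; rewrite inE eqxx.
  by rewrite inE => /andP[/eqP/F_blk-> ].
have inj_f : {in inv_colorings (part r) g &, injective f}.
  move=> F1 F2 h1 h2 E; apply/ffunP=> k; apply/eqP.
  by rewrite -(f_blk _ _ _ h1) E f_blk.
rewrite /fixnum -(card_in_imset inj_f); apply: eq_card => Z.
rewrite inE; apply/andP/imsetP=> [[SZ qZ] | [F Fg ->]]; last first.
  have Sf : in_S (f F).
    apply/in_SP; split=> [i | j]; rewrite ?f_row // f_col.
    by case/inv_coloringsP: Fg.
  split=> //; apply/cZ_eqP=> // i; have [k /eqP <-] := blk_onto i.
  exists (F k) => j; apply: contraNeq; by rewrite f_blk // eq_sym.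
have /in_SP[Z1 Z2] := SZ.
have colZ i : exists j0, [forall j, (j != j0) ==> (Z i j == 0%N :> nat)].
  have /cZ_eqP-/(_ SZ i)[j0 h] := qZ.
  by exists j0; apply/forallP=> j; apply/implyP=> /h ->.
pose c i := xchoose (colZ i).
have cP i j : j != c i -> Z i j = 0%N :> nat.
  by move=> ne; have /forallP/(_ j)/implyP/(_ ne)/eqP := xchooseP (colZ i).
have ZE i j : Z i j = (if c i == j then part q i else 0%N) :> nat.
  have [<- | ne] := eqVneq (c i) j; last by rewrite cP // eq_sym.
  by rewrite -Z1 (bigD1 (c i)) //= big1 ?addn0 // => j' /cP.
pose F : {ffun 'I_n -> 'I_(size (compseq r))} := [ffun k => c (blk q k)].
have FE k : F k = c (blk q k) by rewrite [LHS]ffunE.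
have EZ : Z = f F.
  apply/matrixP=> i j; apply/val_inj/(etrans (ZE i j)); apply: esym.
  apply: (etrans (fE _ _ _)).
  have [Ec | ne] := eqVneq (c i) j.
    rewrite -card_blk; apply: eq_card => k; rewrite !inE FE.
    by case: eqP => // ->; rewrite Ec eqxx.
  apply: eq_card0 => k; rewrite !inE FE.
  by case: eqP => // ->; rewrite (negbTE ne).
exists F => //; apply/inv_coloringsP; split=> [j|].
  by rewrite -f_col -EZ.
by apply/cyc_g=> k k'; rewrite !FE => ->.
Qed.

(** * The right unit *)

Section OnePart.
Variables (n : nat) (e : Defs.comp n).
Hypothesis one_part : compseq e = [:: n].

Let part0 (i j : 'I_(size (compseq e))) : i = j.
Proof.
apply: val_inj; have := ltn_ord i; have := ltn_ord j.
by rewrite {2 4}one_part /= !ltnS !leqn0 => /eqP-> /eqP->.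
Qed.

Lemma fixnum_one_part g : fixnum e g = 1%N.
Proof.
have lt0 : (0 < size (compseq e))%N by rewrite one_part.
apply/eqP/cards1P; exists [ffun => Ordinal lt0]; apply/setP=> F; rewrite inE.
apply/inv_coloringsP/eqP=> [_ | _]; first by apply/ffunP=> k; apply: part0.
split=> [j | k]; last exact: part0.
transitivity #|'I_n|; first by apply: eq_card => k; rewrite !inE; apply/eqP/part0.
by rewrite card_ord -[LHS](sum_part e) (bigD1 j) //= big1 ?addn0 // => i; rewrite (part0 i j) eqxx.
Qed.

(** Makes [Bbar p e] a right unit: a matrix with a single column has at most one nonzero entry per
    row, which forces [cZ Z = compseq q]. *)
Lemma struct_const_one_part p (q w : Defs.comp n) :
  struct_const p q e w = (w == q)%:R.
Proof.
have [-> | ne] := eqVneq w q.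
  have [g cyc_g] := perm_with_cycles (blk q).
  by rewrite (struct_const_diag _ _ cyc_g) fixnum_one_part.
rewrite /struct_const (_ : #|_| = 0%N) //; apply: eq_card0 => Z; rewrite !inE.
apply: contraNF ne => /andP[SZ /eqP Ew]; rewrite -(inj_eq (@compseq_inj n)) -Ew.
apply/cZ_eqP=> // i; have lt0 : (0 < size (compseq e))%N by rewrite one_part.
by exists (Ordinal lt0) => j; rewrite (part0 j (Ordinal lt0)) eqxx.
Qed.

End OnePart.

(** * Divisibility and triangularity of the coloring counts *)

Lemma dvdn_card_inv_colorings n (J : finType) (a : J -> nat) (g : 'S_n) (K : {group {perm J}}) :
    (forall j, 0 < a j)%N -> (forall s j, s \in K -> a (s j) = a j) ->
  (#|K| %| #|inv_colorings a g|)%N.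
Proof.
move=> a_gt0 Ka.
pose to (F : {ffun 'I_n -> J}) (s : {perm J}) : {ffun 'I_n -> J} := [ffun k => s (F k)].
have to1 : to^~ 1%g =1 id by move=> F; apply/ffunP=> k; rewrite ffunE perm1.
have toM F : act_morph to F.
  by move=> s s'; apply/ffunP=> k; rewrite !ffunE permM.
pose To := TotalAction to1 toM.
have actsK : [acts K, on inv_colorings a g | To].
  have sub s F : s \in K -> F \in inv_colorings a g -> to F s \in inv_colorings a g.
    move=> Ks /inv_coloringsP[h1 h2]; apply/inv_coloringsP; split=> [j | k]; last first.
      by rewrite !ffunE h2.
    rewrite -(permKV s j) Ka // -h1; apply: eq_card => k.
    by rewrite !inE ffunE (inj_eq perm_inj).
  apply/actsP=> s Ks F; apply/idP/idP=> [h | ]; last exact: sub.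
  rewrite -(actK To s F); apply: sub => //; exact: groupVr.
rewrite -(acts_sum_card_orbit actsK); apply: dvdn_sum => _ /imsetP[F Fg ->].
(* The action is free: every color has a positive count and so occurs in [F], hence a renaming of
   colors that fixes [F] fixes every color. *)
rewrite card_orbit (_ : 'C_K[F | To] = 1)%g ?indexg1 //.
apply/trivgP/subsetP=> s /setIP[Ks /astab1P/= E]; rewrite inE; apply/eqP/permP=> j.
case/inv_coloringsP: Fg => h _; have : (0 < #|[set k | F k == j]|)%N by rewrite h.
case/card_gt0P=> k; rewrite inE => /eqP <-; rewrite perm1.
by have := congr1 (fun G : {ffun _ -> _} => G k) E; rewrite ffunE.
Qed.

Lemma card_part_eq n (q : Defs.comp n) a : #|[set i | part q i == a]| = count_mem a (compseq q).
Proof.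
rewrite -[in RHS](map_part q) count_map cardsE cardE {1}/enum_mem size_filter enumT.
exact: eq_count.
Qed.

(** The symmetric group on the positions of the repeated part acts by renaming colors; its order is
    the factorial of a number that is at least [p]. *)
Lemma has_prep_dvd_fixnum n p (q : Defs.comp n) (g : 'S_n) :
  (0 < p)%N -> has_prep p q -> (p %| fixnum q g)%N.
Proof.
move=> p_gt0 /hasP[a _ /andP[_ le_p]]; pose A := [set i | part q i == a].
have : (p %| #|perm.Sym_group A|)%N by rewrite perm.card_Sym dvdn_fact // p_gt0 card_part_eq.
move=> /dvdn_trans; apply.
apply: dvdn_card_inv_colorings => [j | s j]; first exact: comp_part_gt0.
rewrite inE => sA; have [Aj | nAj] := boolP (j \in A); last by rewrite (out_perm sA).
by have := perm_closed j sA; rewrite Aj; move: Aj; rewrite !inE => /eqP-> /eqP->.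
Qed.

(** An invariant coloring is a map [c] from the blocks of [q] to the parts of [r]. It is onto
    because no part is zero, and if it is injective then each color class is a single block. *)
Lemma inv_coloring_factor n (q r : Defs.comp n) g F :
    blk_cycles q g -> F \in inv_colorings (part r) g ->
  exists c, [/\ forall k, F k = c (blk q k), forall j, exists i, c i = j
     & injective c -> forall i, part r (c i) = part q i].
Proof.
move=> cyc_g /inv_coloringsP[h /cyc_g F_blk].
pose c i := F (xchoose (blk_onto (q := q) i)).
have Fc k : F k = c (blk q k).
  by apply: F_blk; apply/esym/eqP/(xchooseP (blk_onto _)).
exists c; split=> // [j | inj_c i].
  have : (0 < #|[set k | F k == j]|)%N by rewrite h comp_part_gt0.
  by case/card_gt0P=> k; rewrite inE Fc => /eqP <-; exists (blk q k).
by rewrite -h -card_blk; apply: eq_card => k; rewrite !inE Fc (inj_eq inj_c).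
Qed.

(** The surjection [c] makes [r] at most as long as [q]; for equal lengths it is a bijection
    preserving the sizes of the parts. *)
Lemma fixnum_neq0 n (q r : Defs.comp n) g :
    blk_cycles q g -> fixnum r g != 0%N ->
  (size (compseq r) < size (compseq q))%N || reord q r.
Proof.
move=> cyc_g; rewrite -lt0n => /card_gt0P[F /(inv_coloring_factor cyc_g)[c [_ c_onto c_part]]].
have im_c : image c 'I_(size (compseq q)) =i predT.
  by move=> j; have [i <-] := c_onto j; rewrite image_f.
have card_c : #|image c 'I_(size (compseq q))| = size (compseq r).
  by rewrite (eq_card im_c) card_ord.
have := leq_image_card c 'I_(size (compseq q)).
rewrite card_c card_ord leq_eqVlt => /orP[/eqP Es | -> //].
have inj_c : injective c.
  have /image_injP h : #|image c 'I_(size (compseq q))| == #|'I_(size (compseq q))|.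
    by rewrite card_c card_ord Es.
  by move=> i i'; apply: h.
apply/orP; right; rewrite /reord -(map_part q) -(map_part r).
rewrite -(eq_map (c_part inj_c)) (map_comp (part r) c); apply: perm_map.
apply: uniq_perm => [||j].
- by rewrite map_inj_uniq ?enum_uniq.
- exact: enum_uniq.
by have [i <-] := c_onto j; rewrite mem_enum map_f ?mem_enum.
Qed.

(** The invariant colorings correspond to the group of permutations of positions preserving part
    sizes. If [p] divides its order, Cauchy's theorem gives an element of order [p], and a
    nontrivial orbit of it consists of [p] positions carrying equal parts. *)
Lemma fixnum_diag_dvd n p (q : Defs.comp n) g :
  prime p -> blk_cycles q g -> (p %| fixnum q g)%N -> has_prep p q.
Proof.
move=> p_pr cyc_g.
pose H := [set s : 'S_(size (compseq q)) | [forall i, part q (s i) == part q i]].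
have HP (s : 'S_(size (compseq q))) : reflect (forall i, part q (s i) = part q i) (s \in H).
  by rewrite inE; apply: (iffP forallP) => h i; apply/eqP.
have gH : group_set H.
  apply/group_setP; split; first by apply/HP=> i; rewrite perm1.
  by move=> s s' /HP h /HP h'; apply/HP=> i; rewrite permM h' h.
pose f (s : 'S_(size (compseq q))) : {ffun 'I_n -> 'I_(size (compseq q))} :=
  [ffun k => s (blk q k)].
have fE s k : f s k = s (blk q k) by rewrite [LHS]ffunE.
have inj_f : injective f.
  move=> s s' E; apply/permP=> i; have [k /eqP <-] := blk_onto i.
  by rewrite -!fE E.
have -> : fixnum q g = #|group gH|.
  rewrite -(card_imset _ inj_f); apply: eq_card => F; apply/idP/imsetP.
    move=> Fg; have [c [Fc c_onto c_part]] := inv_coloring_factor cyc_g Fg.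
    have inj_c : injective c.
      have /image_injP h : #|image c 'I_(size (compseq q))| == #|'I_(size (compseq q))|.
        by apply/eqP/eq_card => j; have [i <-] := c_onto j; rewrite image_f.
      by move=> i i'; apply: h.
    exists (perm inj_c); first by apply/HP=> i; rewrite permE c_part.
    by apply/ffunP=> k; rewrite fE permE Fc.
  case=> s /HP Hs ->; apply/inv_coloringsP; split=> [j|].
    rewrite -(permKV s j) Hs -card_blk; apply: eq_card => k.
    by rewrite !inE fE (inj_eq perm_inj).
  by apply/cyc_g=> k k' E; rewrite !fE E.
case/(Cauchy p_pr)=> s /HP Hs os.
have [i ne_i] : exists i, s i != i.
  apply/existsP; apply: contraLR (prime_gt1 p_pr); rewrite negb_exists => /forallP h.
  rewrite -os (_ : s = 1%g) ?order1 //; apply/permP=> i; rewrite perm1.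
  exact/eqP/negPn.
have orb_p : #|porbit s i| = p.
  apply/(prime_nt_dvdP p_pr); last by rewrite -os porbitE dvdn_orbit.
  rewrite porbitE; apply: contraNneq ne_i => /card_orbit1 E.
  by have := mem_porbit s 1 i; rewrite porbitE E expg1 inE.
apply/hasP; exists (part q i); first exact: mem_nth.
rewrite comp_part_gt0 -card_part_eq -{1}orb_p subset_leq_card //.
apply/subsetP=> j /porbitP[m ->]; rewrite inE; apply/eqP.
by elim: m => [|m IHm]; rewrite ?perm1 // expgSr permM Hs.
Qed.

(** * The homomorphism [phi] and multiplication in [Sigma] *)

Section Phi.
Variables n p : nat.
Implicit Types x y : Sigma n p.

Lemma phiE x g : phi x g = \sum_q x q * (fixnum q g)%:R.
Proof. by rewrite ffunE; apply: eq_bigr => q _; rewrite chiE redp_nat. Qed.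

Lemma phi0 g : phi (0 : Sigma n p) g = 0.
Proof. by rewrite phiE big1 // => q _; rewrite ffunE mul0r. Qed.

Lemma phiD x y g : phi (x + y) g = phi x g + phi y g.
Proof.
by rewrite !phiE -big_split; apply: eq_bigr => q _; rewrite ffunE mulrDl.
Qed.

Lemma phiN x g : phi (- x) g = - phi x g.
Proof.
by rewrite !phiE -sumrN; apply: eq_bigr => q _; rewrite ffunE mulNr.
Qed.

Lemma phi_sum (I : Type) (s : seq I) (P : pred I) (F : I -> Sigma n p) g :
  phi (\sum_(i <- s | P i) F i) g = \sum_(i <- s | P i) phi (F i) g.
Proof. by apply: (big_morph (fun x => phi x g)) => [x y|]; rewrite ?phiD ?phi0. Qed.

Lemma phi_scale k x g : phi (scaleS k x) g = k * phi x g.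
Proof.
by rewrite !phiE mulr_sumr; apply: eq_bigr => q _; rewrite ffunE mulrA.
Qed.

Lemma phi_Bbar (q : Defs.comp n) g : phi (Bbar p q) g = (fixnum q g)%:R.
Proof.
rewrite phiE (bigD1 q) //= ffunE eqxx mul1r big1 ?addr0 // => r.
by rewrite ffunE => /negbTE->; rewrite mul0r.
Qed.

Lemma phiM x y g : phi (mulS x y) g = phi x g * phi y g.
Proof.
rewrite !phiE big_distrlr /=.
transitivity (\sum_w \sum_q \sum_r x q * y r * (struct_const p q r w * (fixnum w g)%:R)).
  apply: eq_bigr => w _; rewrite ffunE mulr_suml; apply: eq_bigr => q _.
  by rewrite mulr_suml; apply: eq_bigr => r _; rewrite mulrA.
rewrite exchange_big; apply: eq_bigr => q _; rewrite exchange_big; apply: eq_bigr => r _.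
by rewrite -mulr_sumr -fixnumM_struct mulrACA.
Qed.

Lemma mulSDr x y z : mulS x (y + z) = mulS x y + mulS x z.
Proof.
apply/ffunP=> w; rewrite !ffunE -big_split; apply: eq_bigr => q _.
by rewrite -big_split; apply: eq_bigr => r _; rewrite ffunE mulrDr mulrDl.
Qed.

Lemma mulSNr x y : mulS x (- y) = - mulS x y.
Proof.
apply/ffunP=> w; rewrite !ffunE -sumrN; apply: eq_bigr => q _.
by rewrite -sumrN; apply: eq_bigr => r _; rewrite ffunE mulrN mulNr.
Qed.

Lemma mulS_one_part (e : Defs.comp n) x : compseq e = [:: n] -> mulS x (Bbar p e) = x.
Proof.
move=> one_e; apply/ffunP=> w; rewrite ffunE (bigD1 w) //= [X in _ + X]big1 ?addr0.
  rewrite (bigD1 e) //= struct_const_one_part // ffunE !eqxx !mulr1 big1 ?addr0 // => r.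
  by rewrite ffunE => /negbTE->; rewrite mulr0 mul0r.
move=> q ne; rewrite big1 // => r _; rewrite ffunE.
case: eqP => [-> | _]; last by rewrite mulr0 mul0r.
by rewrite struct_const_one_part // eq_sym (negbTE ne) mulr0.
Qed.

(* In [B_w B_r] the coefficient of [B_w] is [chi_r] at a permutation whose
   cycles are the blocks of [w], so multiplying on the right by an element of
   the kernel kills the leading terms. *)
Lemma mulS_ker_length k x y : phi y = 0 ->
    (forall w : Defs.comp n, (size (compseq w) < k)%N -> x w = 0) ->
  forall w : Defs.comp n, (size (compseq w) < k.+1)%N -> mulS x y w = 0.
Proof.
move=> phi_y x_long w; rewrite ltnS => le_w.
have [g cyc_g] := perm_with_cycles (blk w).
rewrite ffunE (bigD1 w) //= [X in _ + X]big1 ?addr0 => [|q ne_q].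
  transitivity (x w * phi y g); last by rewrite phi_y ffunE mulr0.
  rewrite phiE mulr_sumr; apply: eq_bigr => r _.
  by rewrite (struct_const_diag _ _ cyc_g) mulrA.
apply: big1 => r _; have [-> | /struct_const_neq0] := eqVneq (struct_const p q r w) 0.
  by rewrite mulr0.
rewrite eq_sym (negbTE ne_q) orbF => lt_qw.
by rewrite x_long ?mul0r // (leq_trans lt_qw).
Qed.

End Phi.

Lemma radical_phi0 n p (x : Sigma n p) : (0 < n)%N -> prime p -> radical x -> phi x = 0.
Proof.
move=> n_gt0 p_pr rad_x; apply/ffunP=> g; rewrite [RHS]ffunE.
have [e one_e] : exists e : Defs.comp n, compseq e = [:: n].
  by apply: compseq_onto; rewrite /is_comp /= n_gt0 addn0 eqxx.
have phi_e : phi (Bbar p e) g = 1 by rewrite phi_Bbar fixnum_one_part.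
(* For a fixed [g], the kernel of evaluation of [phi] at [g] is a left ideal, and a maximal one
   because the values lie in a field. *)
apply/eqP; apply: (rad_x (fun z => phi z g == 0)); split.
- split=> [|z t /eqP z0 /eqP t0|a z /eqP z0]; first by rewrite phi0.
    by rewrite phiD phiN z0 t0 subr0.
  by rewrite phiM z0 mulr0.
- by exists (Bbar p e); rewrite phi_e oner_eq0.
move=> J [J0 JB JM] sIJ.
have [/existsP[z /andP[Jz nIz]] | noz] := boolP [exists z, J z && (phi z g != 0)]; last first.
  left=> z Jz; apply: contraNT noz => nz; apply/existsP; exists z.
  by rewrite Jz.
(* [u] is [z] rescaled so that [phi u g = phi t g], which puts [t - u] in the kernel. Since
   [left_ideal] mentions no scalars, the rescaling is a left multiplication by a multiple of
   [Bbar p e]. *)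
right=> t; pose u := mulS (scaleS (phi t g / phi z g) (Bbar p e)) z.
have Ju : J u by apply: JM.
have Jtu : J (t - u).
  apply: sIJ; rewrite phiD phiN phiM phi_scale phi_e mulr1 divfK // subrr //.
rewrite (_ : t = (t - u) - (0 - u)); last by rewrite sub0r opprK subrK.
exact: JB Jtu (JB _ _ J0 Ju).
Qed.

(** By maximality, [J], which is the sum of [I] and the kernel, is [I] or everything. In the first
    case [x] lies in [I]. In the second, [Bbar p e] is [u + y] with [u] in [I] and [y] in the
    kernel, and the nilpotency of [y] brings [Bbar p e] itself into [I], against properness. *)
Lemma phi0_radical n p (x : Sigma n p) : (0 < n)%N -> phi x = 0 -> radical x.
Proof.
move=> n_gt0 phi_x I [[I0 IB IM] [z nIz] maxI].
have [e one_e] : exists e : Defs.comp n, compseq e = [:: n].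
  by apply: compseq_onto; rewrite /is_comp /= n_gt0 addn0 eqxx.
have ID u v : I u -> I v -> I (u + v).
  by move=> Iu Iv; rewrite -[v]opprK -[- v]sub0r; exact: IB Iu (IB _ _ I0 Iv).
pose J : pred (Sigma n p) := fun t => [exists u, I u && (phi (t - u) == 0)].
have JP t : reflect (exists2 u, I u & phi (t - u) = 0) (J t).
  apply: (iffP existsP) => [[u /andP[Iu /eqP E]] | [u Iu E]]; first by exists u.
  by exists u; rewrite Iu E eqxx.
have JI : left_ideal J.
  split.
  - apply/JP; exists 0; rewrite // subrr; apply/ffunP=> g.
    by rewrite phi0 ffunE.
  - move=> t t' /JP[u Iu E] /JP[u' Iu' E']; apply/JP; exists (u - u'); first exact: IB.
    have -> : t - t' - (u - u') = (t - u) - (t' - u') by rewrite !opprD opprK addrACA.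
    by apply/ffunP=> g; rewrite phiD phiN E E' !ffunE subr0.
  - move=> a t /JP[u Iu E]; apply/JP; exists (mulS a u); first exact: IM.
    by apply/ffunP=> g; rewrite -mulSNr -mulSDr phiM E !ffunE mulr0.
have sIJ t : I t -> J t.
  by move=> It; apply/JP; exists t; rewrite // subrr; apply/ffunP=> g; rewrite phi0 ffunE.
have [sJI | allJ] := maxI J JI sIJ.
  by apply: sJI; apply/JP; exists 0; rewrite ?subr0.
have /JP[u Iu phi_y] := allJ (Bbar p e); set y := _ - u in phi_y.
pose pow k := iter k (fun t => mulS t y) (Bbar p e).
have pow_long k : forall w : Defs.comp n, (size (compseq w) < k)%N -> pow k w = 0.
  elim: k => [w | k IHk]; first by rewrite ltn0.
  exact: (mulS_ker_length phi_y IHk).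
(* A composition of [n] has at most [n] parts, so vanishing on all lengths below [n.+1] means being
   0. *)
have pow0 : pow n.+1 = 0.
  apply/ffunP=> w; rewrite pow_long ?ffunE // ltnS size_map; exact: size_bseq.
(* Expanding [pow k] times [Bbar p e] as [pow k] times [u + y] gives a term in [I] plus [pow k.+1];
   so membership descends from [pow n.+1 = 0] to [pow 0]. *)
have I_pow k : I (pow k.+1) -> I (pow k).
  move=> Ik; have -> : pow k = mulS (pow k) u + pow k.+1.
    by rewrite /= -mulSDr addrC subrK mulS_one_part.
  by apply: ID => //; apply: IM.
have I1 : I (Bbar p e).
  rewrite -[Bbar p e]/(pow 0%N); have : I (pow n.+1) by rewrite pow0.
  by elim: n.+1 => // k IHk /I_pow.
by case: nIz; rewrite -(mulS_one_part z one_e); apply: IM.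
Qed.

(** * The spanning set of the kernel *)

Section Span.
Variables (n p : nat).
Hypothesis p_pr : prime p.

Let natr_Fp m : ((m%:R : 'F_p) == 0) = (p %| m)%N.
Proof. by rewrite (dvdn_pcharf (pchar_Fp p_pr)). Qed.

Lemma span_gen_phi0 (x : Sigma n p) : in_span_gen x -> phi x = 0.
Proof.
case=> c [d ->]; apply/ffunP=> g; rewrite phiD !phi_sum ffunE.
rewrite !big1 ?addr0 // => [q prep_q | [q r] /= qr].
  rewrite phi_scale phi_Bbar; apply/eqP; rewrite mulf_eq0 natr_Fp.
  by rewrite has_prep_dvd_fixnum ?prime_gt0 ?orbT.
by rewrite phi_scale phiD phiN !phi_Bbar (fixnum_reord g qr) subrr mulr0.
Qed.

Definition reord_rep (q : Defs.comp n) : Defs.comp n := odflt q [pick r | reord q r].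

Lemma reord_reord_rep q : reord q (reord_rep q).
Proof.
by rewrite /reord_rep; case: pickP => //= _; apply: perm_refl.
Qed.

(** [pick] depends only on the extension of its predicate, so a whole reordering class shares one
    representative; the default value is never reached because [q] is a reordering of itself. *)
Lemma reord_rep_eq (q r : Defs.comp n) : reord q r -> reord_rep q = reord_rep r.
Proof.
rewrite {1}/reord => /permPl qr; have E : reord q =1 reord r by move=> w; apply: qr.
rewrite /reord_rep (eq_pick E); case: pickP => // /(_ r).
by rewrite /reord perm_refl.
Qed.

Lemma reord_rep_id q : reord_rep (reord_rep q) = reord_rep q.
Proof. by rewrite -(reord_rep_eq (reord_reord_rep q)). Qed.

Section Kernel.
Variable x : Sigma n p.
Hypothesis phi_x : phi x = 0.

(** The normal form of [x] modulo the differences of reordered basis elements: all coefficients of a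
    class are collected on its representative. *)
Let y : Sigma n p := [ffun l => \sum_(q | reord_rep q == l) x q].

Let phi_y g : phi y g = 0.
Proof.
rewrite -[RHS](_ : phi x g = 0); last by rewrite phi_x ffunE.
rewrite !phiE [RHS](partition_big reord_rep xpredT) //=.
apply: eq_bigr => l _; rewrite ffunE mulr_suml; apply: eq_bigr => q /eqP <-.
by rewrite (fixnum_reord g (reord_reord_rep q)).
Qed.

Let y_rep l : y l != 0 -> reord_rep l = l.
Proof.
move=> yl; apply/eqP; apply: contraNT yl => ne; rewrite ffunE big1 // => q /eqP El.
by case/eqP: ne; rewrite -El reord_rep_id.
Qed.

(** Induction on length. Evaluate at a permutation whose cycles are the blocks of [l]: a surviving
    term [m] would be shorter than [l], where induction applies, or a reordering of [l], hence equal
    to [l] as both are representatives. What remains is [y l] times a count that is prime to [p]. *)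
Let y0 l : ~~ has_prep p l -> y l = 0.
Proof.
have [k] := ubnP (size (compseq l)); elim: k l => // k IHk l.
rewrite ltnS => le_l prep_l; apply/eqP; apply: contraNT prep_l => yl.
have [g cyc_g] := perm_with_cycles (blk l).
apply: (fixnum_diag_dvd p_pr cyc_g); rewrite -natr_Fp.
have := phi_y g; rewrite phiE (bigD1 l) //= big1 => [|m ne_m]; last first.
  have [-> | ym] := eqVneq (y m) 0; first by rewrite mul0r.
  have [-> | nz] := eqVneq ((fixnum m g)%:R : 'F_p) 0; first by rewrite mulr0.
  have prep_m : ~~ has_prep p m.
    by apply: contra nz; rewrite natr_Fp; apply: has_prep_dvd_fixnum (prime_gt0 p_pr).
  have fix_m : fixnum m g != 0%N by apply: contraNneq nz => ->.
  case/orP: (fixnum_neq0 cyc_g fix_m) => [lt_ml | lm].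
    by rewrite IHk ?mul0r // (leq_trans lt_ml).
  by case/eqP: ne_m; rewrite -(y_rep ym) -(reord_rep_eq lm) y_rep.
by rewrite addr0 => /eqP; rewrite mulf_eq0 (negbTE yl).
Qed.

Lemma phi0_span_gen : in_span_gen x.
Proof.
(* Pairing each [q] only with its representative makes the combination of differences equal to
   [x - y]; the remaining [y] is supported on compositions with a part repeated [p] times. *)
pose c : {ffun Defs.comp n * Defs.comp n -> 'F_p} :=
  [ffun qr => if qr.2 == reord_rep qr.1 then x qr.1 else 0].
have cE q r : c (q, r) = if r == reord_rep q then x q else 0 by rewrite ffunE.
exists c, y; apply/ffunP=> w; rewrite ffunE !sum_ffunE.
have -> : \sum_(qr | reord qr.1 qr.2)
    scaleS (c qr) (Bbar p qr.1 - Bbar p qr.2) w = x w - y w.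
  transitivity (\sum_q \sum_(r | reord q r) scaleS (c (q, r)) (Bbar p q - Bbar p r) w).
    by rewrite pair_big_dep; apply: eq_bigr => -[].
  transitivity (\sum_q (x q * (w == q)%:R - x q * (w == reord_rep q)%:R)).
    apply: eq_bigr => q _; rewrite (bigD1 (reord_rep q)) ?reord_reord_rep //= [scaleS _ _ _]ffunE cE eqxx.
    rewrite !ffunE.
    rewrite big1 ?addr0 -?mulrBr // => r /andP[_ ne].
    by rewrite ffunE cE (negbTE ne) mul0r.
  rewrite sumrB (bigD1 w) //= eqxx mulr1 big1 ?addr0 => [|q]; last first.
    by rewrite eq_sym => /negbTE->; rewrite mulr0.
  congr (_ - _); rewrite ffunE [RHS]big_mkcond; apply: eq_bigr => q _.
  by rewrite eq_sym; case: eqP; rewrite ?mulr1 ?mulr0.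
have -> : \sum_(q | has_prep p q) scaleS (y q) (Bbar p q) w = y w.
  have [prep_w | /y0 yw] := boolP (has_prep p w); last first.
    rewrite yw big1 // => q _; rewrite !ffunE; case: eqP => [<- | _]; last exact: mulr0.
    by move: yw; rewrite ffunE => ->; rewrite mul0r.
  rewrite (bigD1 w) //= ffunE [Bbar _ _ _]ffunE eqxx mulr1 big1 ?addr0 // => q /andP[_ ne].
  by rewrite !ffunE eq_sym (negbTE ne) mulr0.
by rewrite subrK.
Qed.

End Kernel.
End Span.

Theorem theorem2p6 (n p : nat) (hn : (1 <= n)%N) (hp : prime p) :
  (forall x : Sigma n p, radical x <-> phi x = 0) /\
  (forall x : Sigma n p, radical x <-> in_span_gen x).
Proof.
have rad x : @radical n p x <-> phi x = 0.
  by split; [apply: radical_phi0 | apply: phi0_radical].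
split=> // x; split=> [/rad | /(span_gen_phi0 hp)/rad //].
exact: phi0_span_gen.
Qed.
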